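(* Let $K$ be a field, let $\mathcal{A}$ be a laterally complete commutative regular $K$-algebra, let $\nabla$ be the Boolean algebra of all idempotents in $\mathcal{A}$, and let $X$ be a faithful laterally complete $\mathcal{A}$-module. Then there exist a uniquely defined set of pairwise disjoint nonzero idempotents $\{e_i\}_{i\in I}\subset\nabla$ and a (uniquely defined) set of pairwise different cardinal numbers $\{\gamma_i\}_{i\in I}$ such that $\sup_{i\in I}e_i=\mathbf{1}$ and $X_{e_i}$ is a strictly $\gamma_i$-homogeneous $\mathcal{A}_{e_i}$-module for all $i\in I$ (uniqueness meaning that the set of pairs $\{(e_i,\gamma_i)\}_{i\in I}$ is unique). In this case, the $\mathcal{A}$-modules $X$ and $\prod_{i\in I}X_{e_i}$ are isomorphic.
   Context: Algebras. A commutative $K$-algebra $\mathcal{A}$ with unity $\mathbf{1}$ is regular if for every $a\in\mathcal{A}$ there is $b\in\mathcal{A}$ with $a=a^2b$. The set $\nabla=\{e\in\mathcal{A}:e^2=e\}$ of idempotents is a Boolean algebra under $e\le f\iff ef=e$, with $e\wedge f=ef$, $e\vee f=e+f-ef$ and complement $\mathbf{1}-e$. The support $s(a)\in\nabla$ of $a\in\mathcal{A}$ is the smallest idempotent $e$ with $ea=a$ (it exists in a regular algebra). Elements $a,b$ are disjoint if $ab=0$. $\mathcal{A}$ is laterally complete ($l$-complete) if $\nabla$ is a complete Boolean algebra and for any family $\{a_i\}_{i\in I}$ of pairwise disjoint elements of $\mathcal{A}$ there is $a\in\mathcal{A}$ with $as(a_i)=a_i$ for all $i\in I$. A partition of unity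 in $\nabla$ is a family of pairwise disjoint idempotents with supremum $\mathbf{1}$. For $0\ne e\in\nabla$ put $\mathcal{A}_e=e\mathcal{A}$ (a laterally complete commutative regular algebra with unity $e$). Modules. Modules are unital. For an $\mathcal{A}$-module $X$ and $0\neq e\in\nabla$ put $X_e=eX$, an $\mathcal{A}_e$-module. $X$ is faithful if for every nonzero $e\in\nabla$ there is $x\in X$ with $ex\ne0$. $X$ is regular if for every $x\in X$ and $L\subset\nabla$, $ex=0$ for all $e\in L$ implies $(\sup L)x=0$. A regular $\mathcal{A}$-module $X$ is laterally complete ($l$-complete) if for every family $\{x_i\}_{i\in I}\subset X$ and every partition of unity $\{e_i\}_{i\in I}$ in $\nabla$ there is $x\in X$ (necessarily unique, denoted $\mathrm{mix}_{i\in I}(e_ix_i)$) with $e_ix=e_ix_i$ for all $i$. For $E\subset X$, $\mathrm{mix}(E)$ is the set of all mixings $\mathrm{mix}_{i\in I}(e_ix_i)$ with $x_i\in E$ and $\{e_i\}_{i\in I}$ a partition of unity in $\nabla$. $\mathrm{Lin}(Y,\mathcal{A})$ is the set of all finite sums $\sum_k a_ky_k$ with $a_k\in\mathcal{A}$, $y_k\in Y$. A family $\{x_i\}_{i\in I}$ in $X$ is $\mathcal{A}$-linearly independent if for pairwise distinct indices $i_1,\dots,i_n$ and $a_1,\dots,a_n\in\mathcal{A}$, $\sum_k a_kx_{i_k}=0$ implies $a_1=\dots=a_n=0$. An $\mathcal{A}$-Hamel basis of an $l$-complete module $X$ is an $\mathcal{A}$-linearly independent family $\{x_i\}_{i\in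 I}$ with $\mathrm{mix}(\mathrm{Lin}(\{x_i\}_{i\in I},\mathcal{A}))=X$. These notions are applied also to $X_e$ over $\mathcal{A}_e$. The product $\prod_{i\in I}X_{e_i}$ carries coordinate-wise operations. Homogeneity. A faithful $l$-complete $\mathcal{A}$-module $X$ is $\gamma$-homogeneous ($\gamma$ a cardinal) if it has an $\mathcal{A}$-Hamel basis $\{x_i\}_{i\in I}$ with $\mathrm{card}\,I=\gamma$. For $0\ne e\in\nabla$, $\varkappa_X(e)$ is the smallest cardinal $\gamma$ such that the $\mathcal{A}_e$-module $X_e$ is $\gamma$-homogeneous (when such a cardinal exists). $X$ is strictly $\gamma$-homogeneous if it is $\gamma$-homogeneous and $\gamma=\varkappa_X(e)$ for all nonzero $e\in\nabla$. *)

(* Defs.v *)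
From HB Require Import structures.
From mathcomp Require Import all_boot all_order all_algebra.
From mathcomp Require Import boolp classical_sets functions cardinality.

Set Implicit Arguments.
Unset Strict Implicit.
Unset Printing Implicit Defensive.

Import Order.TTheory GRing.Theory.
Local Open Scope classical_set_scope.
Local Open Scope ring_scope.
Local Open Scope card_scope.

(* The notions below only involve the ring structure of a K-algebra, so they
   are set up for commutative rings.  The zero ring is allowed (comPzRingType)
   so that the corner e R is a ring for every idempotent e, including e = 0. *)

Record nabla (R : comPzRingType) := Nabla {
  nabla_val : R;
  nabla_idem : nabla_val ^+ 2 == nabla_val }.

HB.instance Definition _ (R : comPzRingType) :=
  [isSub for @nabla_val R].
HB.instance Definition _ (R : comPzRingType) := [Choice of nabla R by <:].

Fact nabla_display : Order.disp_t. Proof. by []. Qed.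

Section NablaOrder.
Variable R : comPzRingType.
Implicit Types e f g : nabla R.

Lemma nablaM e : val e * val e = val e.
Proof. by rewrite -expr2; apply/eqP/nabla_idem. Qed.

Definition nabla_le e f := val e * val f == val e.

Fact nabla_le_refl : reflexive nabla_le.
Proof. by move=> e; rewrite /nabla_le nablaM. Qed.

Fact nabla_le_anti : antisymmetric nabla_le.
Proof.
move=> e f /andP[/eqP ef /eqP fe]; apply: val_inj => /=.
by rewrite -[LHS]ef mulrC [LHS]fe.
Qed.

Fact nabla_le_trans : transitive nabla_le.
Proof.
by move=> f e g /eqP ef /eqP fg; rewrite /nabla_le -ef -mulrA fg.
Qed.

HB.instance Definition _ := Order.Le_isPOrder.Build nabla_display
  (nabla R) nabla_le_refl nabla_le_anti nabla_le_trans.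

Fact nabla1_subproof : (1 : R) ^+ 2 == 1.
Proof. by rewrite expr1n. Qed.
Definition nabla1 := Nabla nabla1_subproof.

End NablaOrder.
Arguments nabla1 {R}.

(* e R and e X are encoded as the fixed points of multiplication by e, see
   corner_predP and corner_mod_predP; the unity of the ring e R is e. *)

Section Corner.
Variables (R : comPzRingType) (e : nabla R).

Definition corner_pred : {pred R} := fun a => val e * a == a.

Lemma corner_predP a : reflect (exists b, a = val e * b) (a \in corner_pred).
Proof.
apply: (iffP eqP) => [<-|[b ->]]; first by exists a.
by rewrite mulrA nablaM.
Qed.

Fact corner_zmod_closed : zmod_closed corner_pred.
Proof.
split=> [|a b]; rewrite /in_mem /= /corner_pred ?mulr0 //.
by move=> /eqP ea /eqP eb; rewrite mulrBr ea eb.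
Qed.
HB.instance Definition _ :=
  GRing.isZmodClosed.Build R corner_pred corner_zmod_closed.

Record corner := Corner {
  corner_val : R;
  corner_valP : corner_val \in corner_pred }.

HB.instance Definition _ := [isSub for corner_val].
HB.instance Definition _ := [Choice of corner by <:].
HB.instance Definition _ := [SubChoice_isSubZmodule of corner by <:].

Lemma cornerE (a : corner) : val e * val a = val a.
Proof. by apply/eqP; exact: (valP a). Qed.

Fact corner1_subproof : val e \in corner_pred.
Proof. by rewrite /in_mem /= /corner_pred nablaM. Qed.
Definition corner1 := Corner corner1_subproof.

Fact corner_mul_subproof (a b : corner) : val a * val b \in corner_pred.
Proof. by rewrite /in_mem /= /corner_pred mulrA cornerE. Qed.
Definition corner_mul a b := Corner (corner_mul_subproof a b).

Fact corner_mulA : associative corner_mul.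
Proof. by move=> a b c; apply: val_inj; rewrite /= mulrA. Qed.
Fact corner_mulC : commutative corner_mul.
Proof. by move=> a b; apply: val_inj; rewrite /= mulrC. Qed.
Fact corner_mul1 : left_id corner1 corner_mul.
Proof. by move=> a; apply: val_inj; rewrite /= cornerE. Qed.
Fact corner_mulDl : left_distributive corner_mul +%R.
Proof. by move=> a b c; apply: val_inj; rewrite /= mulrDl. Qed.

HB.instance Definition _ := GRing.Zmodule_isComPzRing.Build corner
  corner_mulA corner_mulC corner_mul1 corner_mulDl.

Variable X : lmodType R.

Definition corner_mod_pred : {pred X} := fun x => val e *: x == x.

Lemma corner_mod_predP x :
  reflect (exists y, x = val e *: y) (x \in corner_mod_pred).
Proof.
apply: (iffP eqP) => [<-|[y ->]]; first by exists x.
by rewrite scalerA nablaM.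
Qed.

Fact corner_mod_zmod_closed : zmod_closed corner_mod_pred.
Proof.
split=> [|x y]; rewrite /in_mem /= /corner_mod_pred ?scaler0 //.
by move=> /eqP ex /eqP ey; rewrite scalerBr ex ey.
Qed.
HB.instance Definition _ :=
  GRing.isZmodClosed.Build X corner_mod_pred corner_mod_zmod_closed.

Record corner_mod := CornerMod {
  corner_mod_val : X;
  corner_mod_valP : corner_mod_val \in corner_mod_pred }.

HB.instance Definition _ := [isSub for corner_mod_val].
HB.instance Definition _ := [Choice of corner_mod by <:].
HB.instance Definition _ := [SubChoice_isSubZmodule of corner_mod by <:].

Lemma corner_modE (x : corner_mod) : val e *: val x = val x.
Proof. by apply/eqP; exact: (valP x). Qed.

Fact corner_scale_subproof (a : R) (x : corner_mod) :
  a *: val x \in corner_mod_pred.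
Proof.
by rewrite /in_mem /= /corner_mod_pred scalerA mulrC -scalerA corner_modE.
Qed.

(* The action of the whole ring R on e X; it restricts to the R_e-action. *)
Definition corner_act (a : R) (x : corner_mod) :=
  CornerMod (corner_scale_subproof a x).

Definition corner_scale (a : corner) (x : corner_mod) := corner_act (val a) x.

Fact corner_scaleA a b x :
  corner_scale a (corner_scale b x) = corner_scale (a * b) x.
Proof. by apply: val_inj; rewrite /= scalerA. Qed.
Fact corner_scale1 : left_id 1 corner_scale.
Proof. by move=> x; apply: val_inj; rewrite /= corner_modE. Qed.
Fact corner_scaleDr : right_distributive corner_scale +%R.
Proof. by move=> a x y; apply: val_inj; rewrite /= scalerDr. Qed.
Fact corner_scaleDl x : {morph corner_scale^~ x : a b / a + b}.
Proof. by move=> a b; apply: val_inj; rewrite /= scalerDl. Qed.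

HB.instance Definition _ := GRing.Zmodule_isLmodule.Build corner corner_mod
  corner_scaleA corner_scale1 corner_scaleDr corner_scaleDl.

End Corner.
Arguments corner_mod {R} e X.

Definition corner_prod (R : comPzRingType) (X : lmodType R) (I : Type)
  (e : I -> nabla R) := forall i, corner_mod (e i) X.

Section CornerProd.
Variables (R : comPzRingType) (X : lmodType R) (I : Type) (e : I -> nabla R).
Local Notation P := (corner_prod X e).
Implicit Types f g h : P.

HB.instance Definition _ := gen_eqMixin P.
HB.instance Definition _ := gen_choiceMixin P.

Definition corner_prod0 : P := fun i => 0.
Definition corner_prod_opp f : P := fun i => - f i.
Definition corner_prod_add f g : P := fun i => f i + g i.

Fact corner_prod_addA : associative corner_prod_add.
Proof. by move=> f g h; apply: functional_extensionality_dep => i; exact: addrA. Qed.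
Fact corner_prod_addC : commutative corner_prod_add.
Proof. by move=> f g; apply: functional_extensionality_dep => i; exact: addrC. Qed.
Fact corner_prod_add0 : left_id corner_prod0 corner_prod_add.
Proof. by move=> f; apply: functional_extensionality_dep => i; exact: add0r. Qed.
Fact corner_prod_addN : left_inverse corner_prod0 corner_prod_opp corner_prod_add.
Proof. by move=> f; apply: functional_extensionality_dep => i; exact: addNr. Qed.

HB.instance Definition _ := GRing.isZmodule.Build P
  corner_prod_addA corner_prod_addC corner_prod_add0 corner_prod_addN.

Definition corner_prod_scale (a : R) f : P := fun i => corner_act a (f i).

Fact corner_prod_scaleA a b f :
  corner_prod_scale a (corner_prod_scale b f) = corner_prod_scale (a * b) f.
Proof.
apply: functional_extensionality_dep => i.
by apply: val_inj; rewrite /= scalerA.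
Qed.
Fact corner_prod_scale1 : left_id 1 corner_prod_scale.
Proof.
move=> f; apply: functional_extensionality_dep => i.
by apply: val_inj; rewrite /= scale1r.
Qed.
Fact corner_prod_scaleDr : right_distributive corner_prod_scale +%R.
Proof.
move=> a f g; apply: functional_extensionality_dep => i.
by apply: val_inj; rewrite /= scalerDr.
Qed.
Fact corner_prod_scaleDl f : {morph corner_prod_scale^~ f : a b / a + b}.
Proof.
move=> a b; apply: functional_extensionality_dep => i.
by apply: val_inj; rewrite /= scalerDl.
Qed.

HB.instance Definition _ := GRing.Zmodule_isLmodule.Build R P
  corner_prod_scaleA corner_prod_scale1 corner_prod_scaleDr corner_prod_scaleDl.

End CornerProd.

Section Rings.
Variable R : comPzRingType.

Definition regular_ring := forall a : R, exists b : R, a = a ^+ 2 * b.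

Definition is_supp (a : R) (s : nabla R) :=
  val s * a = a /\ forall e : nabla R, val e * a = a -> (s <= e)%O.

(* The support s(a); the default value is irrelevant for regular rings, by
   is_suppP. *)
Definition supp (a : R) : nabla R := xget nabla1 [set s | is_supp a s].

Lemma is_suppP (a : R) : regular_ring -> is_supp a (supp a).
Proof.
move=> /(_ a)[b ab]; have ide : (a * b) ^+ 2 == a * b.
  by rewrite exprMn expr2 [b ^+ 2]expr2 mulrA -expr2 -ab.
have : exists s, is_supp a s.
  exists (Nabla ide); split=> [|e ea] /=.
    by rewrite mulrAC -expr2 -ab.
  by apply/eqP; rewrite /= mulrC mulrA ea.
by case=> s ss; rewrite /supp; case: xgetP => // /(_ s).
Qed.

Definition partition_of_unity (I : Type) (e : I -> nabla R) :=
  (forall i j, i <> j -> val (e i) * val (e j) = 0) /\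
  supremums (range e) nabla1.

Definition complete_nabla := forall L : set (nabla R), exists s, supremums L s.

Definition laterally_complete :=
  complete_nabla /\
  forall (I : Type) (a : I -> R), (forall i j, i <> j -> a i * a j = 0) ->
    exists b : R, forall i, b * val (supp (a i)) = a i.

End Rings.

Section Modules.
Variables (R : comPzRingType) (X : lmodType R).

Definition faithful_mod :=
  forall e : nabla R, val e != 0 -> exists x : X, val e *: x != 0.

Definition regular_mod :=
  forall (x : X) (L : set (nabla R)),
    (forall e, L e -> val e *: x = 0) ->
    forall s, supremums L s -> val s *: x = 0.

Definition laterally_complete_mod :=
  regular_mod /\
  forall (I : Type) (x : I -> X) (e : I -> nabla R), partition_of_unity e ->
    exists y : X, forall i, val (e i) *: y = val (e i) *: x i.

Definition mix (E : set X) : set X :=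
  [set y | exists (I : Type) (x : I -> X) (e : I -> nabla R),
    [/\ forall i, E (x i), partition_of_unity e &
        forall i, val (e i) *: y = val (e i) *: x i]].

Definition Lin (Y : set X) : set X :=
  [set x | exists (n : nat) (a : 'I_n -> R) (y : 'I_n -> X),
    (forall k, Y (y k)) /\ x = \sum_(k < n) a k *: y k].

Definition lin_indep (I : Type) (x : I -> X) :=
  forall (n : nat) (i : 'I_n -> I) (a : 'I_n -> R), injective i ->
    \sum_(k < n) a k *: x (i k) = 0 -> forall k, a k = 0.

Definition hamel_basis (I : Type) (x : I -> X) :=
  lin_indep x /\ mix (Lin (range x)) = [set: X].

(* A cardinal number is represented by any type of that cardinality: equality
   and order of cardinals are #= and #<= on the full sets of these types. *)
Definition homogeneous (G : Type) :=
  [/\ faithful_mod, laterally_complete_mod &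
      exists (I : Type) (x : I -> X),
        [set: I] #= [set: G] /\ hamel_basis x].

End Modules.

(* is_varkappa X e G: the cardinal varkappa_X(e) exists and equals card G. *)
Definition is_varkappa (R : comPzRingType) (X : lmodType R) (e : nabla R)
    (G : Type) :=
  homogeneous (corner_mod e X) G /\
  forall H : Type, homogeneous (corner_mod e X) H -> [set: G] #<= [set: H].

Definition strictly_homogeneous (R : comPzRingType) (X : lmodType R)
    (G : Type) :=
  homogeneous X G /\ forall e : nabla R, val e != 0 -> is_varkappa X e G.

Definition strictly_homogeneous_decomposition (R : comPzRingType)
    (X : lmodType R) (I : Type) (e : I -> nabla R) (G : I -> Type) :=
  [/\ forall i, val (e i) != 0,
      forall i j, i <> j -> val (e i) * val (e j) = 0,
      forall i j, i <> j -> [set: G i] #!= [set: G j],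
      supremums (range e) nabla1 &
      forall i, strictly_homogeneous (corner_mod (e i) X) (G i)].

(* Inclusion of the set of pairs (e_i, card G_i) in the set of pairs
   (f_j, card H_j). *)
Definition sub_pairs (T I J : Type) (e : I -> T) (G : I -> Type)
    (f : J -> T) (H : J -> Type) :=
  forall i, exists j, e i = f j /\ [set: G i] #= [set: H j].

(* Main.v *)
Require Import Defs.
From HB Require Import structures.
From mathcomp Require Import all_boot all_order all_algebra.
From mathcomp Require Import boolp classical_sets functions cardinality.

Set Implicit Arguments.
Unset Strict Implicit.
Unset Printing Implicit Defensive.

Import Order.TTheory GRing.Theory.
Local Open Scope classical_set_scope.
Local Open Scope ring_scope.
Local Open Scope card_scope.

(** Over the Boolean algebra of idempotents, a faithful laterally complete
    module behaves like a vector space whose dimension varies from place to place, and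
    the decomposition collects the places of equal dimension.

    Everything is done inside [X], with conditions relative to an idempotent:
    a Hamel basis of [e X] is a family that is independent for coefficients in
    [e R] and whose combinations agree with any given vector over a dense set of
    idempotents below [e] ([dense_mixP], [hamel_basis_local]).  Such bases
    restrict to smaller idempotents, and by exhaustion and mixing they can be
    glued over disjoint ones.  The translation to corner modules, and to corners
    of corners, is [strictly_homogeneous_cornerE].

    Existence.  A maximal independent set over [e] need not be a basis of [e X],
    but it is one over some nonzero [g <= e] ([exists_homogeneous_piece]).
    As cardinals are well-founded, some piece below [e] has least possible
    cardinal; this cardinal cannot drop any further, so the piece is strictly
    homogeneous.  Strictly homogeneous pieces are thus dense, those of a given
    cardinal have a largest element ([strictly_homogeneous_on_sup]), and pieces
    of different cardinals are disjoint since a common part would have both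
    cardinals as its least one.  The largest pieces form the decomposition.

    Uniqueness.  If [e i] meets [f j] then their cardinals agree, as both are the
    least cardinal over the common part; since the cardinals of the [f j] are
    pairwise different, [e i] meets only one [f j], lies below it, and by
    symmetry equals it.

    The map sending [x] to the family of the [e i x] is the isomorphism onto the
    product: it is injective by regularity and surjective by mixing. *)

(** * Cardinal numbers *)

Lemma card_setTE (T : Type) (B : set T) : [set: B] #= B.
Proof.
have /card_esym : set_val @` [set: B] #= [set: B].
  by apply: inj_card_eq => x y _ _ /val_inj.
suff -> : set_val @` [set: B] = B by [].
apply/seteqP; split=> [_ [x _ <-]|x Bx]; first exact: set_valP.
by exists (SigSub (mem_set Bx)).
Qed.

Lemma card_le_inj (T U : Type) (f : T -> U) :
  injective f -> [set: T] #<= [set: U].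
Proof.
move=> f_inj.
have /card_esym/card_le_eql -> : range f #= [set: T].
  by apply: inj_card_eq => x y _ _ /f_inj.
exact: card_leT.
Qed.

Lemma card_eq_bij (T U : Type) :
  [set: T] #= [set: U] -> exists f : T -> U, bijective f.
Proof.
move=> /card_bijP[f [g fK gK]].
exists (fun x => set_val (f (SigSub (mem_set (I : setT x))))).
exists (fun x => set_val (g (SigSub (mem_set (I : setT x))))) => x.
  rewrite (_ : SigSub _ = f (SigSub (mem_set (I : setT x)))) ?fK //.
  exact: val_inj.
rewrite (_ : SigSub _ = g (SigSub (mem_set (I : setT x)))) ?gK //.
exact: val_inj.
Qed.

(** Cardinals are well-founded: consider sets [S] of choice functions of the
    family [Q] that are injective in every coordinate.  A maximal one must
    exhaust some coordinate [C], since otherwise a choice function avoiding all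
    values of [S] could be added; then sending the [C]-coordinate of [s] in [S]
    to its [D]-coordinate injects [C] into every [D]. *)
Lemma exists_least_card (T : Type) (Q : set (set T)) (C0 : set T) : Q C0 ->
  exists2 C, Q C & forall D, Q D -> [set: C] #<= [set: D].
Proof.
move=> QC0.
pose good (S : set (set T -> T)) :=
  (forall s C, S s -> Q C -> C (s C)) /\
  (forall s t C, S s -> S t -> Q C -> s C = t C -> s = t).
have [F F_good F_tot|S [[SQ S_inj] S_max]] := @Zorn_bigcup _ good.
  split=> [s C [S FS Ss]|s t C [S FS Ss] [S' FS' S't]].
    by have [+ _] := F_good _ FS; apply.
  have [SS'|S'S] := F_tot _ _ FS FS'.
    by have [_] := F_good _ FS'; apply=> //; apply: SS'.
  by have [_] := F_good _ FS; apply=> //; apply: S'S.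
have [C [QC C_exh]] : exists C, Q C /\ forall a, C a -> exists2 s, S s & s C = a.
  apply: contrapT => /forallNP noC.
  have {}noC C : exists a, Q C -> C a /\ forall s, S s -> s C <> a.
    have noC' C' : Q C' -> exists a, C' a /\ forall s, S s -> s C' <> a.
      move=> QC'; apply: contrapT => /forallNP noa; apply: (noC C'); split=> //.
      move=> a Ca; apply: contrapT => nos; apply: (noa a); split=> // s Ss sa.
      by apply: nos; exists s.
    (* Outside [Q] the value is irrelevant; [C0] only shows that [T] has one. *)
    have [QC|nQC] := pselect (Q C); first by have [a] := noC' _ QC; exists a.
    by have [a _] := noC' _ QC0; exists a.
  have [t tP] := choice noC.
  apply: (S_max (S `|` [set t])).
    split=> [s Ss|/(_ t (or_intror erefl)) St]; first by left.
    by have [_ /(_ _ St)] := tP _ QC0.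
  split=> [s C [Ss|->] QC|s s' C]; first exact: (SQ s C).
    by have [] := tP _ QC.
  move=> [Ss|->] [Ss'|->] QC //; first exact: (S_inj s s' C).
    by have [_ /(_ _ Ss)] := tP _ QC.
  by have [_ /(_ _ Ss') + /esym] := tP _ QC.
exists C => // D QD.
have /choice[s sP] : forall a : C, exists s, S s /\ s C = set_val a.
  by move=> a; have [s] := C_exh _ (set_valP a); exists s.
have sD a : D (s a D) by have [Sa _] := sP a; exact: (SQ (s a) D).
apply: (@card_le_inj _ _ (fun a => SigSub (mem_set (sD a)))).
move=> a b /(congr1 set_val) /= sab; apply: val_inj; change (set_val a = set_val b).
have [[Sa <-] [Sb <-]] := (sP a, sP b); congr (_ C).
exact: S_inj sab.
Qed.

(** * Idempotents *)

Section Idempotents.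
Variable R : comPzRingType.
Implicit Types (e f g h : nabla R) (L P : set (nabla R)).

Lemma nleP e f : reflect (val e * val f = val e) (e <= f)%O.
Proof. exact: eqP. Qed.

Fact nmeet_subproof e f : (val e * val f) ^+ 2 == val e * val f.
Proof. by rewrite exprMn !expr2 !nablaM. Qed.
Definition nmeet e f : nabla R := Nabla (nmeet_subproof e f).

Fact ncompl_subproof e : (1 - val e) ^+ 2 == 1 - val e.
Proof.
by rewrite expr2 mulrBr mulr1 mulrBl mul1r nablaM subrr subr0.
Qed.
Definition ncompl e : nabla R := Nabla (ncompl_subproof e).

Lemma val_nmeet e f : val (nmeet e f) = val e * val f. Proof. by []. Qed.

Lemma nmeet_lel e f : (nmeet e f <= e)%O.
Proof. by apply/nleP; rewrite /= mulrAC nablaM. Qed.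

Lemma nmeet_ler e f : (nmeet e f <= f)%O.
Proof. by apply/nleP; rewrite /= -mulrA nablaM. Qed.

Lemma nle1 e : (e <= nabla1)%O.
Proof. by apply/nleP; rewrite /= mulr1. Qed.

Lemma nle_complP e f : reflect (val e * val f = 0) (e <= ncompl f)%O.
Proof.
apply: (iffP (nleP _ _)) => /=; rewrite mulrBr mulr1.
  by move/eqP; rewrite -subr_eq0 addrAC subrr sub0r oppr_eq0 => /eqP.
by move=> ->; rewrite subr0.
Qed.

Lemma nle_complC e f : (e <= ncompl f)%O -> (f <= ncompl e)%O.
Proof. by move=> /nle_complP ef; apply/nle_complP; rewrite mulrC. Qed.

(** Meets distribute over suprema, in the form used throughout: an idempotent
    disjoint from all of [L] has a complement that is an upper bound of [L]. *)
Lemma sup_meets L s f : supremums L s -> val f * val s != 0 ->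
  exists2 g, L g & val f * val g != 0.
Proof.
move=> [_ s_least] fs; apply: contrapT => noL; move/eqP: fs; apply.
apply/nle_complP/nle_complC/s_least => g Lg; apply/nle_complC/nle_complP.
by apply: contrapT => /eqP fg; apply: noL; exists g.
Qed.

Lemma nle_neq0 e f : (e <= f)%O -> val e != 0 -> val f != 0.
Proof. by move=> /nleP <-; apply: contra => /eqP ->; rewrite mulr0. Qed.

Lemma sup1_meets L :
  supremums L nabla1 <->
  forall f, val f != 0 -> exists2 g, L g & val f * val g != 0.
Proof.
split=> [L1 f f0|L_meets]; first by apply: (sup_meets L1); rewrite /= mulr1.
split=> [g _|u u_ub]; first exact: nle1.
suff u0 : val (ncompl u) == 0.
  by apply/nleP => /=; rewrite mul1r; apply/esym/eqP; rewrite -subr_eq0.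
apply: contrapT => /negP/L_meets[g /u_ub /nleP gu].
by rewrite /= mulrBl mul1r mulrC gu subrr eqxx.
Qed.

(** The idempotent [e] is the support of [a]; having it as a multiple of [a]
    allows dividing by [a] over it. *)
Lemma regular_idem_multiple (a : R) : regular_ring R -> a != 0 ->
  exists b e, [/\ val e = b * a, val e * a = a & val e != 0].
Proof.
move=> /(_ a)[b ab] a0.
have eM : b * a * a = a by rewrite -mulrA -expr2 mulrC.
have ide : (b * a) ^+ 2 == b * a by rewrite expr2 mulrCA mulrA -mulrA eM.
exists b, (Nabla ide); split=> //=.
by apply: contra a0 => /eqP ba; rewrite -eM ba mul0r.
Qed.

(** Exhaustion: a maximal disjoint family of members of [P] below [e]
    meets every nonzero idempotent below [e] once [P] is dense below [e], since
    the part of [e] that it misses would contain another member. *)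
Lemma exhaustion e P :
    (forall f, (f <= e)%O -> val f != 0 ->
       exists g, [/\ (g <= f)%O, val g != 0 & P g]) ->
  exists S : set (nabla R),
    [/\ forall g, S g -> (g <= e)%O /\ P g,
        forall g h, S g -> S h -> g <> h -> val g * val h = 0 &
        forall f, (f <= e)%O -> val f != 0 ->
          exists2 g, S g & val f * val g != 0].
Proof.
move=> P_dense.
pose good (S : set (nabla R)) :=
  (forall g, S g -> (g <= e)%O /\ P g) /\
  (forall g h, S g -> S h -> g <> h -> val g * val h = 0).
have [F F_good F_tot|S [[SP S_disj] S_max]] := @Zorn_bigcup _ good.
  split=> [g [S FS Sg]|g h [S FS Sg] [S' FS' S'h]].
    by have [+ _] := F_good _ FS; apply.
  have [SS'|S'S] := F_tot _ _ FS FS'.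
    by have [_] := F_good _ FS'; apply=> //; apply: SS'.
  by have [_] := F_good _ FS; apply=> //; apply: S'S.
exists S; split=> // f fe f0; apply: contrapT => noS.
have [g [gf g0 Pg]] := P_dense f fe f0.
have Sg0 h : S h -> val g * val h = 0.
  move=> Sh; apply: contrapT => /eqP gh; apply: noS; exists h => //.
  apply: contra gh => /eqP fh; move/nleP: gf => <-.
  by rewrite -mulrA fh mulr0.
apply: (S_max (S `|` [set g])).
  split=> [h Sh|/(_ g (or_intror erefl))/Sg0]; first by left.
  by rewrite nablaM; apply/eqP.
split=> [h [/SP //|->]|h h']; first by split=> //; apply: le_trans fe.
move=> [Sh|->] [Sh'|->] // neq; first exact: S_disj.
  by rewrite mulrC Sg0.
by rewrite Sg0.
Qed.

End Idempotents.

(** * Bases over an idempotent *)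

(** These definitions describe the corner module [e X] without leaving [X], so
    that passing from [e] to a smaller idempotent needs no change of ring. *)

Section LocalBases.
Variables (R : comPzRingType) (X : lmodType R).
Implicit Types (e f g h : nabla R) (x y z : X) (E : set X).

Definition indep_on e (I : Type) (x : I -> X) :=
  forall (n : nat) (i : 'I_n -> I) (a : 'I_n -> R), injective i ->
    (forall k, val e * a k = a k) ->
    \sum_(k < n) a k *: x (i k) = 0 -> forall k, a k = 0.

(** Being a mixing of elements of [E] amounts to agreeing with elements of [E]
    over a dense set of idempotents; this form has the advantage of being
    inherited by smaller idempotents. *)
Definition dense_on e E :=
  forall y f, (f <= e)%O -> val f != 0 ->
    exists g z, [/\ (g <= f)%O, val g != 0, E z & val g *: y = val g *: z].

Definition local_basis e (I : Type) (x : I -> X) :=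
  indep_on e x /\ dense_on e (Lin (range x)).

Definition homogeneous_on e (G : Type) := exists x : G -> X, local_basis e x.

Definition strictly_homogeneous_on e (G : Type) :=
  homogeneous_on e G /\
  forall f (H : Type), (f <= e)%O -> val f != 0 -> homogeneous_on f H ->
    [set: G] #<= [set: H].

Lemma scale_nle e f x y :
  (e <= f)%O -> val f *: x = val f *: y -> val e *: x = val e *: y.
Proof. by move=> /nleP <- fxy; rewrite -!scalerA fxy. Qed.

Lemma Lin_rangeP (I : Type) (x : I -> X) z :
  Lin (range x) z <->
  exists n (a : 'I_n -> R) (i : 'I_n -> I), z = \sum_k a k *: x (i k).
Proof.
split=> [[n [a [y [yx ->]]]]|[n [a [i ->]]]].
  have /choice[i xi] : forall k, exists i, x i = y k.
    by move=> k; have [i _] := yx k; exists i.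
  by exists n, a, i; apply: eq_bigr => k _; rewrite xi.
by exists n, a, (x \o i); split=> // k; exists (i k).
Qed.

Lemma dense_mixP E : mix E = [set: X] <-> dense_on nabla1 E.
Proof.
split=> [mixE y f _ f0|E_dense].
  have [I [x [e [Ex [_ /sup1_meets/(_ f f0)[_ [i _ <-] fe0]] ey]]]] : mix E y.
    by rewrite mixE.
  exists (nmeet f (e i)), (x i); split=> //; first exact: nmeet_lel.
  exact: scale_nle (nmeet_ler _ _) (ey i).
apply/seteqP; split=> // y _.
pose P g := exists2 z, E z & val g *: y = val g *: z.
have [|S [SP S_disj S_meets]] := @exhaustion _ nabla1 P.
  move=> f f1 f0; have [g [z [gf g0 Ez gyz]]] := E_dense y f f1 f0.
  by exists g; split=> //; exists z.
have /choice[x xP] : forall g : S, exists x,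
    E x /\ val (set_val g) *: y = val (set_val g) *: x.
  by move=> g; have [_ [x Ex gyx]] := SP _ (set_valP g); exists x.
exists S, x, set_val; split=> [g| |g]; try by case: (xP g).
split=> [g h gh|].
  apply: S_disj; [exact: set_valP|exact: set_valP|].
  by move=> eq_gh; apply: gh; apply: val_inj.
apply/sup1_meets => f /(S_meets f (nle1 f))[g Sg fg0]; exists g => //.
by exists (SigSub (mem_set Sg)).
Qed.

Lemma hamel_basis_local (I : Type) (x : I -> X) :
  hamel_basis x <-> local_basis nabla1 x.
Proof.
rewrite /hamel_basis /local_basis dense_mixP.
suff -> : lin_indep x = indep_on nabla1 x by [].
apply: propext; split=> x_indep n i a i_inj.
  by move=> _; apply: x_indep.
by apply: x_indep => // k; rewrite mul1r.
Qed.

Lemma indep_on_sub e f (I : Type) (x : I -> X) :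
  (f <= e)%O -> indep_on e x -> indep_on f x.
Proof.
move=> /nleP fe x_indep n i a i_inj fa; apply: x_indep => // k.
by rewrite -(fa k) mulrA [val e * _]mulrC fe.
Qed.

Lemma homogeneous_on_sub e f (G : Type) :
  (f <= e)%O -> homogeneous_on e G -> homogeneous_on f G.
Proof.
move=> fe [x [x_indep x_dense]]; exists x; split.
  exact: indep_on_sub x_indep.
by move=> y g gf; apply: x_dense; apply: le_trans fe.
Qed.

Lemma local_basis_bij e (I J : Type) (x : I -> X) (p : J -> I) :
  bijective p -> local_basis e x -> local_basis e (x \o p).
Proof.
move=> [q pK qK] [x_indep x_dense].
have p_inj : injective p := can_inj pK.
split=> [n i a i_inj|].
  by apply: x_indep => k l /p_inj/i_inj.
suff -> : range (x \o p) = range x by [].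
by apply/seteqP; split=> [_ [j _ <-]|_ [i _ <-]];
  [exists (p j)|exists (q i) => //=; rewrite qK].
Qed.

Lemma homogeneous_on_card e (G H : Type) :
  [set: G] #= [set: H] -> homogeneous_on e G -> homogeneous_on e H.
Proof.
move=> /card_esym/card_eq_bij[p p_bij] [x x_basis]; exists (x \o p).
exact: local_basis_bij.
Qed.

Lemma indep_on_inj e (I : Type) (x : I -> X) :
  val e != 0 -> indep_on e x -> injective x.
Proof.
move=> e0 x_indep i j xij; apply: contrapT => ij.
pose i2 (k : 'I_2) := if k == ord0 then i else j.
pose a2 (k : 'I_2) := if k == ord0 then val e else - val e.
suff /(_ ord0)/eqP : forall k, a2 k = 0 by rewrite (negPf e0).
apply: (x_indep _ i2).
- move=> [[|[|k]] k2] [[|[|l]] l2] //; rewrite /i2 /= => eq_ij;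
    solve [exact: val_inj|by case: ij].
- by move=> k; rewrite /a2; case: ifP => _; rewrite ?mulrN nablaM.
- by rewrite !big_ord_recl big_ord0 /= xij addr0 scaleNr subrr.
Qed.

(** Bases can be taken to be subsets of [X], so a set suffices to represent all
    cardinals of bases. *)
Lemma homogeneous_on_set e (G : Type) : val e != 0 -> homogeneous_on e G ->
  exists2 B : set X, homogeneous_on e B & [set: B] #= [set: G].
Proof.
move=> e0 Ge; have [x [x_indep _]] := Ge.
have rangeG : [set: range x] #= [set: G].
  apply: card_eq_trans (card_setTE _) _.
  by apply: inj_card_eq => i j _ _; apply: indep_on_inj x_indep i j.
by exists (range x) => //; apply: homogeneous_on_card Ge; apply: card_esym.
Qed.

End LocalBases.

(** * Existence of homogeneous pieces *)

Section IndependentSets.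
Variables (R : comPzRingType) (X : lmodType R).
Implicit Types (e f g h : nabla R) (x y z : X) (B : set X).

(** Indexing by elements of [X] rather than of the subtype [B] makes the
    condition compatible with unions of chains. *)
Definition indep_set e B :=
  forall (n : nat) (i : 'I_n -> X) (a : 'I_n -> R), injective i ->
    (forall k, B (i k)) -> (forall k, val e * a k = a k) ->
    \sum_(k < n) a k *: i k = 0 -> forall k, a k = 0.

Lemma indep_set_on e B : indep_set e B -> indep_on e (@set_val _ B).
Proof.
move=> B_indep n i a i_inj; apply: B_indep => [|k]; last exact: set_valP.
by move=> k l /val_inj/i_inj.
Qed.

Lemma range_set_val (T : Type) (B : set T) : range (@set_val _ B) = B.
Proof.
apply/seteqP; split=> [_ [x _ <-]|x Bx]; first exact: set_valP.
by exists (SigSub (mem_set Bx)).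
Qed.

Lemma chain_finite_bound (T : Type) (F : set (set T)) n (i : 'I_n.+1 -> T) :
  total_on F subset -> (forall k, (\bigcup_(B in F) B) (i k)) ->
  exists2 B, F B & forall k, B (i k).
Proof.
move=> F_tot; elim: n i => [|n IHn] i iF.
  by have [B FB Bi] := iF ord0; exists B => // k; rewrite (ord1 k).
have [B FB Bi] := IHn (i \o lift ord0) (fun k => iF _).
have [B' FB' B'i] := iF ord0.
have [BB'|B'B] := F_tot _ _ FB FB'; [exists B'|exists B] => // k.
  by case: (unliftP ord0 k) => [l|] -> //; apply: BB'; apply: Bi.
by case: (unliftP ord0 k) => [l|] ->; [apply: Bi|apply: B'B].
Qed.

Lemma exists_maximal_indep_set e :
  exists2 B, indep_set e B & forall y, indep_set e (B `|` [set y]) -> B y.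
Proof.
have [F F_indep F_tot|B [B_indep B_max]] := @Zorn_bigcup _ (indep_set e).
  move=> [|n] i a i_inj iF ea sum0; first by case.
  have [B FB iB] := chain_finite_bound F_tot iF.
  exact: (F_indep B FB _ i a).
exists B => // y By_indep; apply: contrapT => nBy; apply: B_max By_indep.
by split=> [x Bx|/(_ y (or_intror erefl))]; first by left.
Qed.

(** If the coefficient [a] of [y] in a vanishing combination were nonzero,
    dividing by [a] over its support would express [y] there through [B]. *)
Lemma indep_setU1 e B y : regular_ring R -> indep_set e B ->
    (forall h z, (h <= e)%O -> val h != 0 -> Lin B z ->
       val h *: y <> val h *: z) ->
  indep_set e (B `|` [set y]).
Proof.
move=> R_reg B_indep y_free n i a i_inj iBy ea sum0.
have [[k0 ik0]|/forallNP noy] := pselect (exists k, i k = y); last first.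
  apply: (B_indep n i a i_inj _ ea sum0) => k.
  by case: (iBy k) => // iky; case: (noy k).
case: n => [|n] in i a i_inj iBy ea sum0 k0 ik0 *; first by case: k0 {ik0}.
have iB k : B (i (lift k0 k)).
  case: (iBy (lift k0 k)) => //; rewrite -ik0 => /i_inj/eqP.
  by rewrite eq_sym (negPf (neq_lift _ _)).
move: sum0; rewrite (bigD1_ord k0) //= ik0 => sum0.
have a0 : a k0 = 0.
  apply: contrapT => /eqP/(regular_idem_multiple R_reg)[b [h [hE _ h0]]].
  pose z := \sum_k (- b * a (lift k0 k)) *: i (lift k0 k).
  have hy : val h *: y = z.
    rewrite hE -scalerA; move/eqP: sum0; rewrite addr_eq0 => /eqP ->.
    rewrite scalerN -scaleNr scaler_sumr; apply: eq_bigr => k _.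
    by rewrite scalerA.
  apply: (y_free h z _ h0).
  - by apply/nleP; rewrite hE -mulrA [a k0 * _]mulrC ea.
  - by exists n, (fun k => - b * a (lift k0 k)), (i \o lift k0).
  - by rewrite -hy scalerA nablaM.
move: sum0; rewrite a0 scale0r add0r => sum0 k.
case: (unliftP k0 k) => [l|] -> //.
apply: (B_indep _ (i \o lift k0) (a \o lift k0)) => // [p q|p].
  by move=> /i_inj/lift_inj.
exact: ea.
Qed.

End IndependentSets.

Section Pieces.
Variables (R : comPzRingType) (X : lmodType R).
Hypotheses (R_reg : regular_ring R) (R_complete : complete_nabla R).
Hypothesis X_lc : laterally_complete_mod X.
Implicit Types (e f g h : nabla R) (x y z : X) (B : set X).

(** Mixing only needs disjointness: the values over the part that the family
    misses may be prescribed to be [0]. *)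
Lemma disjoint_mixing (I : Type) (e : I -> nabla R) (x : I -> X) :
    (forall i j, i <> j -> val (e i) * val (e j) = 0) ->
  exists y, forall i, val (e i) *: y = val (e i) *: x i.
Proof.
move=> e_disj; have [s [s_ub s_least]] := R_complete (range e).
pose e' o := if o is Some i then e i else ncompl s.
have [|y yP] := X_lc.2 (option I) (fun o => if o is Some i then x i else 0) e'.
  have se i : (e i <= s)%O by apply: s_ub; exists i.
  have ce i : val (e i) * val (ncompl s) = 0.
    by rewrite /= mulrBr mulr1; move/nleP: (se i) => ->; rewrite subrr.
  split=> [[i|] [j|] //= ij|].
  - by apply: e_disj => eq_ij; apply: ij; rewrite eq_ij.
  - exact: ce.
  - by rewrite mulrC ce.
  split=> [f _|u u_ub]; first exact: nle1.
  have /nleP su : (s <= u)%O.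
    by apply: s_least => _ [i _ <-]; apply: u_ub; exists (Some i).
  have /nleP : (ncompl s <= u)%O by apply: u_ub; exists None.
  rewrite /= mulrBl mul1r su => /eqP; rewrite subr_eq subrK => /eqP u1.
  by apply/nleP; rewrite /= u1 mulr1.
by exists y => i; apply: (yP (Some i)).
Qed.

Lemma disjoint_set_mixing (S : set (nabla R)) (x : nabla R -> X) :
    (forall g h, S g -> S h -> g <> h -> val g * val h = 0) ->
  exists y, forall g, S g -> val g *: y = val g *: x g.
Proof.
move=> S_disj.
have [|y yP] := @disjoint_mixing S set_val (x \o set_val).
  move=> g h gh; apply: S_disj; [exact: set_valP|exact: set_valP|].
  by move=> eq_gh; apply: gh; apply: val_inj.
by exists y => g Sg; apply: (yP (SigSub (mem_set Sg))).
Qed.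

(** A maximal independent set [B] over [e] is a basis over some piece of [e].
    Otherwise every piece of [e] contains a smaller piece carrying a vector that
    agrees nowhere below with a combination of [B]; mixing these vectors over
    an exhausting family of pieces gives one such vector for the whole of [e],
    and it can be added to [B]. *)
Lemma exists_homogeneous_piece e : val e != 0 ->
  exists g B, [/\ (g <= e)%O, val g != 0 & homogeneous_on X g B].
Proof.
move=> e0; have [B B_indep B_max] := exists_maximal_indep_set X e.
pose free h y := forall f z, (f <= h)%O -> val f != 0 -> Lin B z ->
  val f *: y <> val f *: z.
apply: contrapT => no_piece.
have free_dense f : (f <= e)%O -> val f != 0 ->
    exists g, [/\ (g <= f)%O, val g != 0 & exists y, free g y].
  move=> fe f0; apply: contrapT => no_free; apply: no_piece.
  exists f, B; split=> //; exists set_val; split.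
    exact/(indep_on_sub fe)/indep_set_on.
  rewrite range_set_val => y g gf g0.
  have : ~ free g y.
    by move=> gy; apply: no_free; exists g; split=> //; exists y.
  move=> /existsNP[h /existsNP[z /not_implyP[hg /not_implyP[h0]]]].
  by move=> /not_implyP[Bz /contrapT hyz]; exists h, z.
have [S [S_free S_disj S_meets]] := exhaustion free_dense.
have /choice[x xP] : forall g, exists y, S g -> free g y.
  move=> g; have [/S_free[_ [y gy]]|nSg] := pselect (S g); first by exists y.
  by exists 0.
have [y yP] := disjoint_set_mixing x S_disj.
have y_free : free e y.
  move=> f z fe f0 Bz fyz; have [g Sg fg0] := S_meets f fe f0.
  apply: (xP g Sg (nmeet f g) z) => //; first exact: nmeet_ler.
  rewrite -(scale_nle (nmeet_ler f g) (yP g Sg)).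
  exact: scale_nle (nmeet_lel f g) fyz.
(* By maximality [y] lies in [B], so it agrees with the combination [y]. *)
apply: (y_free e y) => //.
exists 1%N, (fun=> 1), (fun=> y); split=> [_|]; last first.
  by rewrite big_ord1 scale1r.
exact/B_max/(indep_setU1 R_reg).
Qed.

(** Take a piece of [e] of least cardinal.  Every homogeneous piece of this piece
    is one of [e], so its cardinal cannot be smaller. *)
Lemma exists_strictly_homogeneous_piece e : val e != 0 ->
  exists g B, [/\ (g <= e)%O, val g != 0 & strictly_homogeneous_on X g B].
Proof.
move=> e0; have [g0 [B0 [g0e g0_neq0 B0_hom]]] := exists_homogeneous_piece e0.
pose Q (B : set X) :=
  exists g, [/\ (g <= e)%O, val g != 0 & homogeneous_on X g B].
have QB0 : Q B0 by exists g0.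
have [B [g [ge g_neq0 B_hom]] B_least] := exists_least_card QB0.
exists g, B; split=> //; split=> // f H fg f0 H_hom.
have [C C_hom CH] := homogeneous_on_set f0 H_hom.
rewrite -(card_le_eqr CH); apply: B_least.
by exists f; split=> //; apply: le_trans ge.
Qed.

Lemma strictly_homogeneous_on_sub e f (G : Type) : (f <= e)%O ->
  strictly_homogeneous_on X e G -> strictly_homogeneous_on X f G.
Proof.
move=> fe [G_hom G_least]; split; first exact: homogeneous_on_sub G_hom.
by move=> g H gf; apply: G_least; apply: le_trans fe.
Qed.

Lemma strictly_homogeneous_on_card e (G H : Type) : [set: G] #= [set: H] ->
  strictly_homogeneous_on X e G -> strictly_homogeneous_on X e H.
Proof.
move=> GH [G_hom G_least]; split; first exact: homogeneous_on_card G_hom.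
by move=> f C fe f0 /(G_least f C fe f0); rewrite (card_le_eql GH).
Qed.

Lemma strictly_homogeneous_on_eq e f (G H : Type) :
    strictly_homogeneous_on X e G -> strictly_homogeneous_on X f H ->
  val e * val f != 0 -> [set: G] #= [set: H].
Proof.
move=> [G_hom G_least] [H_hom H_least] ef0; apply/card_eqPle; split.
  apply: (G_least (nmeet e f)) => //; first exact: nmeet_lel.
  exact: homogeneous_on_sub (nmeet_ler _ _) H_hom.
apply: (H_least (nmeet e f)) => //; first exact: nmeet_ler.
exact: homogeneous_on_sub (nmeet_lel _ _) G_hom.
Qed.

(** Mixing bases index by index: the bases over a disjoint family exhausting [s]
    combine to a basis over [s] as soon as they have the same index type. *)
Lemma homogeneous_on_exhausted s (S : set (nabla R)) (G : Type) :
    (forall g, S g -> (g <= s)%O /\ homogeneous_on X g G) ->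
    (forall g h, S g -> S h -> g <> h -> val g * val h = 0) ->
    (forall f, (f <= s)%O -> val f != 0 ->
       exists2 g, S g & val f * val g != 0) ->
  homogeneous_on X s G.
Proof.
move=> S_hom S_disj S_meets.
have /choice[b bP] : forall g, exists b : G -> X, S g -> local_basis g b.
  move=> g; have [/S_hom[_ [b gb]]|nSg] := pselect (S g); first by exists b.
  by exists (fun=> 0).
have /choice[x xP] : forall i : G, exists x,
    forall g, S g -> val g *: x = val g *: b g i.
  by move=> i; apply: (disjoint_set_mixing (b ^~ i)).
exists x; split=> [n i a i_inj sa sum0 k|y f fs f0].
  have ga g : S g -> val g * a k = 0.
    move=> Sg; have [b_indep _] := bP g Sg.
    apply: (b_indep _ i (fun l => val g * a l) i_inj) => [l|].
      by rewrite mulrA nablaM.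
    transitivity (val g *: (\sum_l a l *: x (i l))); last first.
      by rewrite sum0 scaler0.
    rewrite scaler_sumr; apply: eq_bigr => l _.
    by rewrite mulrC -scalerA -xP // !scalerA mulrC.
  apply: contrapT => /eqP/(regular_idem_multiple R_reg)[c [h [hE _ h0]]].
  have [|g Sg /eqP] := S_meets h _ h0.
    by apply/nleP; rewrite hE -mulrA [a k * _]mulrC sa.
  by rewrite hE -mulrA [a k * _]mulrC ga // mulr0.
have [g Sg fg0] := S_meets f fs f0; have [_ b_dense] := bP g Sg.
have [h [z [hfg h0 /Lin_rangeP[n [a [i ->]]] hy]]] :=
  b_dense y (nmeet f g) (nmeet_ler f g) fg0.
exists h, (\sum_k a k *: x (i k)); split=> //.
- exact: le_trans (nmeet_lel f g).
- by apply/Lin_rangeP; exists n, a, i.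
rewrite hy !scaler_sumr; apply: eq_bigr => k _.
rewrite !scalerA ![val h * a k]mulrC -!scalerA; congr (_ *: _).
apply/esym/(scale_nle _ (xP (i k) g Sg)).
exact: le_trans (nmeet_ler f g).
Qed.

(** The members of [L] have a disjoint exhausting family of smaller pieces, over
    which their bases glue; and a basis over any [f <= s] restricts to a part
    common with some member of [L], which bounds its cardinal from below.  So
    for each cardinal there is a largest strictly homogeneous piece. *)
Lemma strictly_homogeneous_on_sup s (L : set (nabla R)) (G : Type) :
    (forall g, L g -> strictly_homogeneous_on X g G) -> supremums L s ->
  strictly_homogeneous_on X s G.
Proof.
move=> L_hom Ls.
have L_dense f : (f <= s)%O -> val f != 0 ->
    exists g, [/\ (g <= f)%O, val g != 0 & strictly_homogeneous_on X g G].
  move=> /nleP fs f0; have [|g /L_hom g_hom fg0] := sup_meets (f := f) Ls.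
    by rewrite fs.
  exists (nmeet f g); split=> //; first exact: nmeet_lel.
  exact: strictly_homogeneous_on_sub (nmeet_ler _ _) g_hom.
have [S [S_hom S_disj S_meets]] := exhaustion L_dense.
split=> [|f H fs f0 H_hom].
  by apply: (homogeneous_on_exhausted _ S_disj S_meets) => g /S_hom[? []].
have [g [gf g0 [_ G_least]]] := L_dense f fs f0.
by apply: (G_least g) => //; apply: homogeneous_on_sub H_hom.
Qed.

End Pieces.

(** * Corner modules *)

Section Corners.
Variables (R : comPzRingType) (e : nabla R).

Fact nabla_of_corner_subproof (f : nabla (corner e)) :
  val (val f) ^+ 2 == val (val f).
Proof. by rewrite expr2 -[_ * _]/(val (val f * val f)) nablaM. Qed.
Definition nabla_of_corner (f : nabla (corner e)) : nabla R :=
  Nabla (nabla_of_corner_subproof f).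

Lemma nabla_of_corner_le (f g : nabla (corner e)) :
  (nabla_of_corner f <= nabla_of_corner g)%O = (f <= g)%O.
Proof.
by apply/nleP/nleP => [fg|/(congr1 val)//]; apply: val_inj.
Qed.

Lemma nabla_of_corner_sub f : (nabla_of_corner f <= e)%O.
Proof. by apply/nleP; rewrite /= mulrC cornerE. Qed.

Lemma nabla_of_corner_eq0 f : (val (nabla_of_corner f) == 0) = (val f == 0).
Proof. by []. Qed.

Lemma nabla_of_corner1 : nabla_of_corner nabla1 = e.
Proof. exact: val_inj. Qed.

Lemma nabla_of_corner_surj f :
  (f <= e)%O -> exists f', nabla_of_corner f' = f.
Proof.
move=> /nleP fe; have fP : val f \in corner_pred e.
  by rewrite /in_mem /= /corner_pred mulrC fe.
have f_idem : Corner fP ^+ 2 == Corner fP.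
  by rewrite expr2; apply/eqP/val_inj; rewrite /= nablaM.
by exists (Nabla f_idem); apply: val_inj.
Qed.

Lemma nabla_of_corner_sup (L : set (nabla (corner e))) s :
  supremums L s <-> supremums (nabla_of_corner @` L) (nabla_of_corner s).
Proof.
split=> [[s_ub s_least]|[s_ub s_least]]; split.
- by move=> _ [f Lf <-]; rewrite nabla_of_corner_le; apply: s_ub.
- move=> u u_ub; have [u' u'E] := nabla_of_corner_surj (nmeet_ler u e).
  apply: le_trans (nmeet_lel u e); rewrite -u'E nabla_of_corner_le.
  apply: s_least => f Lf; rewrite -nabla_of_corner_le u'E.
  have /nleP fu : (nabla_of_corner f <= u)%O by apply: u_ub; exists f.
  have /nleP fe := nabla_of_corner_sub f.
  by apply/nleP; rewrite val_nmeet mulrA fu fe.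
- by move=> f Lf; rewrite -nabla_of_corner_le; apply: s_ub; exists f.
- move=> u u_ub; rewrite -nabla_of_corner_le; apply: s_least => _ [f Lf <-].
  by rewrite nabla_of_corner_le; apply: u_ub.
Qed.

Lemma corner_complete : complete_nabla R -> complete_nabla (corner e).
Proof.
move=> R_complete L; have [s Ls] := R_complete (nabla_of_corner @` L).
have [|s' s'E] := @nabla_of_corner_surj s.
  by case: Ls => _; apply=> _ [f _ <-]; apply: nabla_of_corner_sub.
by exists s'; apply/nabla_of_corner_sup; rewrite s'E.
Qed.

Variable X : lmodType R.
Local Notation eX := (corner_mod e X).

Fact corner_proj_subproof (x : X) : val e *: x \in @corner_mod_pred R e X.
Proof. by apply/corner_mod_predP; exists x. Qed.
Definition corner_proj (x : X) : eX := CornerMod (corner_proj_subproof x).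

Lemma corner_faithful : faithful_mod X -> faithful_mod eX.
Proof.
move=> X_faithful f f0.
have [x fx0] := X_faithful (nabla_of_corner f) f0.
exists (corner_proj x); apply: contra fx0 => /eqP/(congr1 val) /=.
by rewrite scalerA mulrC cornerE => /eqP.
Qed.

Lemma corner_laterally_complete : complete_nabla R ->
  laterally_complete_mod X -> laterally_complete_mod eX.
Proof.
move=> R_complete X_lc; split=> [x L Lx0 s Ls|I x f [f_disj _]].
  apply/val_inj/(X_lc.1 _ (nabla_of_corner @` L) _ (nabla_of_corner s)).
    by move=> _ [f /Lx0/(congr1 val) fx0 <-].
  exact/nabla_of_corner_sup.
have [|y yP] := disjoint_mixing R_complete X_lc
    (e := nabla_of_corner \o f) (val \o x).
  by move=> i j /f_disj/(congr1 val).
exists (corner_proj y) => i; apply: val_inj => /=.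
by rewrite scalerA mulrC cornerE; apply: yP.
Qed.

Lemma val_corner_sum n (a : 'I_n -> corner e) (x : 'I_n -> eX) :
  val (\sum_k a k *: x k) = \sum_k val (a k) *: val (x k).
Proof. by rewrite raddf_sum. Qed.

Lemma corner_indep_on f (I : Type) (x : I -> eX) :
  indep_on f x <-> indep_on (nabla_of_corner f) (val \o x).
Proof.
split=> x_indep n i a i_inj fa sum0 k.
  have /nleP fe := nabla_of_corner_sub f.
  have ea l : a l \in corner_pred e.
    by apply/corner_predP; exists (a l); rewrite -(fa l) mulrA [val e * _]mulrC fe.
  apply: (congr1 val (x_indep n i (fun l => Corner (ea l)) i_inj _ _ k)) => [l|].
    exact/val_inj/fa.
  by apply: val_inj; rewrite val_corner_sum.
apply/val_inj/(x_indep n i (fun l => val (a l)) i_inj) => [l|].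
  by have /(congr1 val) := fa l.
by move/(congr1 val): sum0; rewrite val_corner_sum.
Qed.

Lemma corner_dense_on f (I : Type) (x : I -> eX) :
  dense_on f (Lin (range x)) <->
  dense_on (nabla_of_corner f) (Lin (range (val \o x))).
Proof.
split=> x_dense y h hf h0.
  have [h' h'E] := nabla_of_corner_surj (le_trans hf (nabla_of_corner_sub f)).
  have [||g [z [gh g0 /Lin_rangeP[n [a [i ->]]] /(congr1 val) gyz]]] :=
    x_dense (corner_proj y) h'.
  - by rewrite -nabla_of_corner_le h'E.
  - by rewrite -nabla_of_corner_eq0 h'E.
  exists (nabla_of_corner g), (\sum_k val (a k) *: val (x (i k))); split=> //.
  - by rewrite -h'E nabla_of_corner_le.
  - by apply/Lin_rangeP; exists n, (fun k => val (a k)), i.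
  move: gyz => /=; rewrite val_corner_sum scalerA [_ * val e]mulrC cornerE.
  by [].
have [||g [z [gh g0 /Lin_rangeP[n [a [i ->]]] gyz]]] :=
  x_dense (val y) (nabla_of_corner h).
- by rewrite nabla_of_corner_le.
- by rewrite nabla_of_corner_eq0.
have [g' g'E] := nabla_of_corner_surj (le_trans gh (nabla_of_corner_sub h)).
have ea k : val e * a k \in corner_pred e by apply/corner_predP; exists (a k).
exists g', (\sum_k Corner (ea k) *: x (i k)); split.
- by rewrite -nabla_of_corner_le g'E.
- by rewrite -nabla_of_corner_eq0 g'E.
- by apply/Lin_rangeP; exists n, (fun k => Corner (ea k)), i.
apply: val_inj; rewrite /= val_corner_sum.
have -> : val (val g') = val g by rewrite -g'E.
rewrite gyz; congr (_ *: _); apply: eq_bigr => k _ /=.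
by rewrite mulrC -scalerA corner_modE.
Qed.

Lemma corner_homogeneous_on f (G : Type) :
  homogeneous_on eX f G <-> homogeneous_on X (nabla_of_corner f) G.
Proof.
split=> [[x [/corner_indep_on x_indep /corner_dense_on x_dense]]|].
  by exists (val \o x).
move=> [x [x_indep x_dense]]; exists (corner_proj \o x).
have /nleP := nabla_of_corner_sub f; rewrite /= => fe.
split; [apply/corner_indep_on|apply/corner_dense_on].
  move=> n i a i_inj fa sum0; apply: (x_indep n i a i_inj fa).
  rewrite -[RHS]sum0; apply: eq_bigr => k _ /=.
  by rewrite scalerA -(fa k) mulrAC fe.
move=> y h hf h0; have [g [z [gh g0 /Lin_rangeP[n [a [i ->]]] gyz]]] :=
  x_dense y h hf h0.
exists g, (\sum_k a k *: (val e *: x (i k))); split=> //.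
  by apply/Lin_rangeP; exists n, a, i.
have /nleP ge := le_trans gh (le_trans hf (nabla_of_corner_sub f)).
rewrite gyz !scaler_sumr; apply: eq_bigr => k _.
by rewrite !scalerA mulrAC ge.
Qed.

End Corners.

(** * Homogeneity of corner modules *)

Lemma homogeneousE (R : comPzRingType) (X : lmodType R) (G : Type) :
    faithful_mod X -> laterally_complete_mod X ->
  homogeneous X G <-> homogeneous_on X nabla1 G.
Proof.
move=> X_faithful X_lc; split=> [[_ _ [I [x [IG /hamel_basis_local x_basis]]]]|].
  by apply: homogeneous_on_card IG _; exists x.
move=> [x x_basis]; split=> //; exists G, x; split; first exact: card_eqxx.
exact/hamel_basis_local.
Qed.

Lemma homogeneous_cornerE (R : comPzRingType) (X : lmodType R)
    (R_complete : complete_nabla R) (X_faithful : faithful_mod X)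
    (X_lc : laterally_complete_mod X) (e : nabla R) (G : Type) :
  homogeneous (corner_mod e X) G <-> homogeneous_on X e G.
Proof.
rewrite homogeneousE; last 2 first.
- exact: corner_faithful.
- exact: corner_laterally_complete.
by rewrite corner_homogeneous_on nabla_of_corner1.
Qed.

(** Strictness of [e X] refers to corners of the corner [e X]; an idempotent [f]
    of [e R] is also one of [R], and cuts out the same part of [X]. *)
Lemma strictly_homogeneous_cornerE (R : comPzRingType) (X : lmodType R)
    (R_complete : complete_nabla R) (X_faithful : faithful_mod X)
    (X_lc : laterally_complete_mod X) (e : nabla R) (G : Type) :
  strictly_homogeneous (corner_mod e X) G <-> strictly_homogeneous_on X e G.
Proof.
have nestedE f H : homogeneous (corner_mod f (corner_mod e X)) H <->
    homogeneous_on X (nabla_of_corner f) H.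
  rewrite homogeneous_cornerE ?corner_homogeneous_on //.
  - exact: corner_complete.
  - exact: corner_faithful.
  - exact: corner_laterally_complete.
split=> [[/homogeneous_cornerE G_hom G_least]|[G_hom G_least]].
  split=> [|f H /nabla_of_corner_surj[f' <-] f0 f_hom]; first exact: G_hom.
  by have [_] := G_least f' f0; apply; apply/nestedE.
split=> [|f f0]; first exact/homogeneous_cornerE.
split=> [|H /nestedE]; last first.
  by apply: G_least => //; apply: nabla_of_corner_sub.
apply/nestedE; exact: homogeneous_on_sub (nabla_of_corner_sub f) G_hom.
Qed.

(** * The decomposition *)

Section Product.
Variables (R : comPzRingType) (X : lmodType R) (I : Type) (e : I -> nabla R).

Definition corner_prod_proj (x : X) : corner_prod X e :=
  fun i => corner_proj (e i) x.

Fact corner_prod_proj_linear : linear corner_prod_proj.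
Proof.
move=> a x y; apply: functional_extensionality_dep => i; apply: val_inj => /=.
by rewrite scalerDr !scalerA mulrC.
Qed.
HB.instance Definition _ :=
  GRing.isLinear.Build R X (corner_prod X e) *:%R corner_prod_proj
    corner_prod_proj_linear.

(** Regularity gives injectivity and lateral completeness surjectivity. *)
Lemma corner_prod_proj_bij : laterally_complete_mod X ->
  partition_of_unity e -> bijective corner_prod_proj.
Proof.
move=> [X_reg X_mix] e_part.
have /choice[psi psiP] : forall z : corner_prod X e, exists y,
    forall i, val (e i) *: y = val (z i).
  move=> z; have [y yP] := X_mix I (fun i => val (z i)) e e_part.
  by exists y => i; rewrite yP corner_modE.
exists psi => [x|z]; last first.
  apply: functional_extensionality_dep => i; apply: val_inj => /=.
  exact: psiP.
apply/eqP; rewrite -subr_eq0 -[_ - _]scale1r; apply/eqP.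
apply: X_reg e_part.2 => _ [i _ <-].
by rewrite scalerBr psiP /= subrr.
Qed.

End Product.

Section Decomposition.
Variables (R : comPzRingType) (X : lmodType R).
Hypotheses (R_reg : regular_ring R) (R_complete : complete_nabla R).
Hypotheses (X_faithful : faithful_mod X) (X_lc : laterally_complete_mod X).

(** For each cardinal take the largest idempotent over which [X] is strictly
    homogeneous of that cardinal.  Representing cardinals by subsets of [X]
    loses none, and indexing by the idempotents themselves makes the cardinals
    pairwise different. *)
Lemma strict_decomposition_exists :
  exists (I : Type) (e : I -> nabla R) (G : I -> Type),
    strictly_homogeneous_decomposition X e G.
Proof.
pose largest (e : nabla R) (B : set X) := strictly_homogeneous_on X e B /\
  forall f, strictly_homogeneous_on X f B -> (f <= e)%O.
pose I := [set e : nabla R | val e != 0 /\ exists B, largest e B].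
have /choice[G GP] : forall i : I, exists B, largest (set_val i) B.
  by move=> i; have [] := set_valP i.
have eq_card (i j : I) : [set: G i] #= [set: G j] -> i = j.
  move=> Gij; apply: val_inj; have [[Gi i_max] [Gj j_max]] := (GP i, GP j).
  apply/le_anti/andP; split.
    exact: (j_max _ (strictly_homogeneous_on_card Gij Gi)).
  exact: (i_max _ (strictly_homogeneous_on_card (card_esym Gij) Gj)).
exists I, set_val, G; split=> [i|i j ij|i j ij||i].
- by have [] := set_valP i.
- apply: contrapT => /eqP ij0; apply/ij/eq_card.
  have [[Gi _] [Gj _]] := (GP i, GP j).
  exact: (strictly_homogeneous_on_eq Gi Gj ij0).
- by apply/negP => /eq_card.
- apply/sup1_meets => f /(exists_strictly_homogeneous_piece R_reg R_complete X_lc).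
  move=> [g [B [gf g0 B_hom]]].
  have [s Ls] := R_complete [set h | strictly_homogeneous_on X h B].
  have gs : (g <= s)%O by apply: Ls.1.
  have sP : val s != 0 /\ exists B, largest s B.
    split; first exact: nle_neq0 gs g0.
    exists B; split=> [|h h_hom]; last exact: Ls.1.
    exact: strictly_homogeneous_on_sup Ls.
  exists s; first by exists (SigSub (mem_set (sP : I s))).
  apply: (@nle_neq0 _ g (nmeet f s)) => //.
  move/nleP: gf => gf; move/nleP: gs => gs.
  by apply/nleP; rewrite val_nmeet mulrA gf gs.
by apply/strictly_homogeneous_cornerE => //; have [] := GP i.
Qed.

Section TwoDecompositions.
Variables (I J : Type) (e : I -> nabla R) (G : I -> Type).
Variables (f : J -> nabla R) (H : J -> Type).
Hypotheses (De : strictly_homogeneous_decomposition X e G).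
Hypotheses (Df : strictly_homogeneous_decomposition X f H).

Lemma strict_decomposition_meet_card i j :
  val (e i) * val (f j) != 0 -> [set: G i] #= [set: H j].
Proof.
apply: (@strictly_homogeneous_on_eq _ X).
  by apply/strictly_homogeneous_cornerE => //; case: De.
by apply/strictly_homogeneous_cornerE => //; case: Df.
Qed.

(** Since [e i] shares its cardinal with every [f k] that it meets and these
    cardinals are pairwise different, it meets [f j] only, and the [f k] have
    supremum [1]. *)
Lemma strict_decomposition_meet_le i j :
  val (e i) * val (f j) != 0 -> (e i <= f j)%O.
Proof.
move=> ij0; have [_ _ H_neq /sup1_meets f_meets _] := Df.
suff : val (nmeet (e i) (ncompl (f j))) = 0.
  by rewrite /= mulrBr mulr1 => /eqP; rewrite subr_eq0 => /eqP/esym/nleP.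
apply: contrapT => /eqP/f_meets[_ [k _ <-]].
have [<-|jk] := pselect (j = k).
  by rewrite /= -mulrA mulrBl mul1r nablaM subrr mulr0 eqxx.
rewrite val_nmeet mulrAC => ijk0; move/negP: (H_neq j k jk); apply.
have Gij := strict_decomposition_meet_card ij0.
apply: card_eq_trans (card_esym Gij) _; apply: strict_decomposition_meet_card.
by apply: contra ijk0 => /eqP ->; rewrite mul0r.
Qed.

End TwoDecompositions.

Lemma strict_decomposition_sub_pairs (I J : Type)
    (e : I -> nabla R) (G : I -> Type) (f : J -> nabla R) (H : J -> Type) :
  strictly_homogeneous_decomposition X e G ->
  strictly_homogeneous_decomposition X f H -> sub_pairs e G f H.
Proof.
move=> De Df i; have [e_neq0 _ _ _ _] := De.
have [_ _ _ /sup1_meets f_meets _] := Df.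
have [_ [j _ <-] ij0] := f_meets _ (e_neq0 i); exists j; split.
  apply/le_anti/andP; split; first exact: (strict_decomposition_meet_le De Df ij0).
  by apply: (strict_decomposition_meet_le Df De); rewrite mulrC.
exact: (strict_decomposition_meet_card De Df ij0).
Qed.

End Decomposition.

Theorem theorem5p2 (K : fieldType) (A : comAlgType K) (X : lmodType A)
    (A_reg : regular_ring A) (A_lc : laterally_complete A)
    (X_faithful : faithful_mod X) (X_lc : laterally_complete_mod X) :
  [/\ exists (I : Type) (e : I -> nabla A) (G : I -> Type),
        strictly_homogeneous_decomposition X e G,
      forall (I J : Type) (e : I -> nabla A) (G : I -> Type)
          (f : J -> nabla A) (H : J -> Type),
        strictly_homogeneous_decomposition X e G ->
        strictly_homogeneous_decomposition X f H ->
        sub_pairs e G f H /\ sub_pairs f H e G &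
      forall (I : Type) (e : I -> nabla A) (G : I -> Type),
        strictly_homogeneous_decomposition X e G ->
        exists phi : {linear X -> corner_prod X e}, bijective phi].
Proof.
have A_complete := A_lc.1; split.
- exact: strict_decomposition_exists.
- move=> I J e G f H De Df; split.
    exact: (strict_decomposition_sub_pairs A_complete X_faithful X_lc De Df).
  exact: (strict_decomposition_sub_pairs A_complete X_faithful X_lc Df De).
move=> I e G [_ e_disj _ e_sup _].
by exists (@corner_prod_proj _ X I e); apply: corner_prod_proj_bij.
Qed.
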